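(* Let $[a,b]\subset[-1,1]$ with $a<b$, let $d\ge 1$ be an integer, and let $q_d(\theta)=\frac{c_0}{2}+\sum_{j=1}^{d}\rho_{j,d}c_j\cos(j\theta)$ be the Chebyshev--Jackson trigonometric polynomial of degree $d$ associated with $[a,b]$. Then $q_d(\theta)\in[0,1]$ for all $\theta\in\mathbb{R}$.
   Context: The Fourier coefficients (of the step function equal to $1$ on $(a,b)$, $\tfrac12$ at $a$ and $b$, and $0$ on $[-1,1]\setminus[a,b]$) are $c_0=\frac{2}{\pi}(\arccos(a)-\arccos(b))$ and $c_j=\frac{2}{\pi}\,\frac{\sin(j\arccos(a))-\sin(j\arccos(b))}{j}$ for $j=1,\dots,d$. The Jackson damping factors are $$\rho_{j,d}=\frac{(d+2-j)\sin(\frac{\pi}{d+2})\cos(\frac{j\pi}{d+2})+\cos(\frac{\pi}{d+2})\sin(\frac{j\pi}{d+2})}{(d+2)\sin\frac{\pi}{d+2}}.$$ Equivalently $q_d(\theta)=\psi_d(\cos\theta)$ with $\psi_d(x)=\frac{c_0}{2}+\sum_{j=1}^d\rho_{j,d}c_jT_j(x)$, $T_j$ the Chebyshev polynomials of the first kind. *)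

(* Defs.v *)
From mathcomp Require Import all_boot all_order all_algebra.
From mathcomp Require Import reals trigo.
Set Implicit Arguments.
Unset Strict Implicit.
Unset Printing Implicit Defensive.
Import Order.TTheory GRing.Theory Num.Theory.
Local Open Scope ring_scope.

(* Coefficients of the expansion c_0 / 2 + \sum_(j >= 1) c_j cos (j theta) of
   the step function of [a, b] evaluated at cos theta; [acos] is the inverse of
   [cos] on [0, pi]. *)
Definition step_coef (R : realType) (a b : R) (j : nat) : R :=
  if j is 0%N then 2 / pi * (acos a - acos b)
  else 2 / pi * ((sin (j%:R * acos a) - sin (j%:R * acos b)) / j%:R).

Definition jackson_factor (R : realType) (d j : nat) : R :=
  let h := pi / (d%:R + 2) in
  ((d%:R + 2 - j%:R) * sin h * cos (j%:R * h) + cos h * sin (j%:R * h))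
  / ((d%:R + 2) * sin h).

Definition chebyshev_jackson (R : realType) (a b : R) (d : nat) (theta : R) : R :=
  step_coef a b 0 / 2
  + \sum_(1 <= j < d.+1)
      jackson_factor R d j * step_coef a b j * cos (j%:R * theta).

(* Main.v *)
Require Import Defs.
From mathcomp Require Import all_boot all_order all_algebra.
From mathcomp Require Import reals trigo.
From mathcomp Require Import ring lra.
From mathcomp Require Import boolp topology normedtype derive realfun.
Import Order.TTheory GRing.Theory Num.Theory.
Import numFieldNormedType.Exports.
Local Open Scope ring_scope.

(** Up to normalisation, [chebyshev_jackson a b d] is the convolution of the
2 pi-periodic even function that indicates [a <= cos theta <= b] with the
Jackson kernel [K t = 1/2 + \sum_(1 <= j <= d) rho_j cos (j t)], so everything
rests on [K >= 0].

The kernel is nonnegative because it is a squared modulus.  With [N = d + 2],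
[h = pi / N] and [s_k = sin ((k + 1) h)],
[N K(t) = |\sum_(0 <= k <= d) s_k e^(i k t)|^2].  Expanding the square
([sum_cos_sin_sqr]) gives a cosine polynomial whose coefficients are the
autocorrelations [\sum_k s_k s_(k+j)], and these evaluate in closed form to
multiples of the factors [rho_j] ([sine_autocorrelation]).

The convolution is handled through an explicit primitive, which avoids
integrals.  For fixed [theta] put
[H t = t/2 + \sum_j rho_j cos (j theta) sin (j t) / j].  The formula for the
[c_j] says that the polynomial at [theta] equals
[2/pi * (H (acos a) - H (acos b))], while
[H' t = (K (t + theta) + K (t - theta)) / 2 >= 0], so [H] is nondecreasing.
Since [0 <= acos b <= acos a <= pi], [H 0 = 0] and [H pi = pi / 2], the
difference lies between [0] and [pi/2], and the polynomial between [0] and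
[1]. *)

(** This is [|\sum_k s_k e^(i k t)|^2] written with real quantities: the terms
with index difference [j] contribute [2 cos (j t)] times the autocorrelation of
[s] at lag [j]. *)
Lemma sum_cos_sin_sqr (R : realType) (s : nat -> R) (n : nat) (t : R) :
  (\sum_(0 <= k < n) s k * cos (k%:R * t)) ^+ 2
    + (\sum_(0 <= k < n) s k * sin (k%:R * t)) ^+ 2
  = \sum_(0 <= k < n) s k ^+ 2
    + 2 * \sum_(1 <= j < n)
            (\sum_(0 <= k < n - j) s k * s (k + j)%N) * cos (j%:R * t).
Proof.
elim: n => [|n IHn]; first by rewrite !big_geq // expr0n /= mulr0 !addr0.
(* The products of the new term with all the earlier ones, sorted by lag. *)
have cross : \sum_(1 <= j < n.+1) s (n - j)%N * s n * cos (j%:R * t)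
    = s n * (cos (n%:R * t) * \sum_(0 <= k < n) s k * cos (k%:R * t)
             + sin (n%:R * t) * \sum_(0 <= k < n) s k * sin (k%:R * t)).
  rewrite big_nat_rev /= big_add1 /= !mulr_sumr -big_split mulr_sumr /=.
  apply: eq_big_nat => k /andP[_ ltkn].
  have -> : (1 + n.+1 - k.+2 = n - k)%N by rewrite add1n subSS.
  rewrite subKn ?(ltnW ltkn) // natrB ?(ltnW ltkn) // mulrBl cosB; ring.
(* Passing from [n] to [n.+1] lengthens each autocorrelation by one product. *)
have shells : \sum_(1 <= j < n.+1)
      (\sum_(0 <= k < n.+1 - j) s k * s (k + j)%N) * cos (j%:R * t)
    = \sum_(1 <= j < n)
        (\sum_(0 <= k < n - j) s k * s (k + j)%N) * cos (j%:R * t)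
      + \sum_(1 <= j < n.+1) s (n - j)%N * s n * cos (j%:R * t).
  transitivity (\sum_(1 <= j < n.+1)
      ((\sum_(0 <= k < n - j) s k * s (k + j)%N) * cos (j%:R * t)
       + s (n - j)%N * s n * cos (j%:R * t))).
    apply: eq_big_nat => j /andP[_ ltjn].
    by rewrite subSn // big_nat_recr //= subnK // mulrDl.
  rewrite big_split /=; congr (_ + _).
  case: n {IHn cross} => [|n]; first by rewrite !big_geq.
  by rewrite big_nat_recr //= subnn [X in X * _]big_geq // mul0r addr0.
rewrite shells cross !(big_nat_recr n) //=.
have := cos2Dsin2 (n%:R * t).
move: IHn; set C := \sum_(0 <= k < n) _ * cos _.
set S := \sum_(0 <= k < n) _ * sin _.
set P := \sum_(0 <= k < n) _ ^+ 2; set Q := \sum_(1 <= j < n) _.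
move: (cos _) (sin _) => c z IHn cz.
transitivity (C ^+ 2 + S ^+ 2 + 2 * s n * (c * C + z * S)
              + s n ^+ 2 * (c ^+ 2 + z ^+ 2)); first by ring.
by rewrite cz IHn; ring.
Qed.


(** Multiplying by [2 sin h] makes the sum telescope. *)
Lemma sin_mul_sum_cos_progression (R : realType) (h x : R) (n : nat) :
  2 * sin h * \sum_(0 <= k < n) cos (x + 2 * k%:R * h)
  = sin (x + (2 * n%:R - 1) * h) - sin (x - h).
Proof.
elim: n => [|n IHn].
  by rewrite big_geq // !mulr0 sub0r mulN1r subrr.
rewrite big_nat_recr //= mulrDr IHn.
set y := x + 2 * n%:R * h.
have -> : x + (2 * n%:R - 1) * h = y - h by rewrite /y; ring.
have -> : x + (2 * n.+1%:R - 1) * h = y + h.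
  by rewrite /y -natr1; ring.
rewrite (sinB y) (sinD y); ring.
Qed.

(** The products turn into [cos (j h) - cos ((2 k + j + 2) h)], and the second
terms form an arithmetic progression.  The value [(d + 2) h = pi] enters by
folding the upper end of the telescoped sum back onto its lower end, up to a
full period.  The right-hand side is the numerator of [jackson_factor R d j]. *)
Lemma sine_autocorrelation (R : realType) (d j : nat) : (j <= d)%N ->
  let h := pi / (d%:R + 2) : R in
  2 * sin h
    * \sum_(0 <= k < d.+1 - j) sin (k.+1%:R * h) * sin ((k + j).+1%:R * h)
  = (d%:R + 2 - j%:R) * sin h * cos (j%:R * h) + cos h * sin (j%:R * h).
Proof.
move=> lejd h.
have hN : (d%:R + 2) * h = pi.
  by rewrite mulrC divfK // gt_eqF // ltr_wpDl.
pose n := (d.+1 - j)%N.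
have En : n%:R = d%:R + 1 - j%:R :> R by rewrite natrB ?leqW // -natr1.
have -> : \sum_(0 <= k < n) sin (k.+1%:R * h) * sin ((k + j).+1%:R * h)
    = \sum_(0 <= k < n)
        (cos (j%:R * h) - cos ((j%:R + 2) * h + 2 * k%:R * h)) / 2.
  apply: eq_bigr => k _.
  have -> : j%:R * h = (k + j).+1%:R * h - k.+1%:R * h.
    by rewrite -!natr1 natrD; ring.
  have -> : (j%:R + 2) * h + 2 * k%:R * h = (k + j).+1%:R * h + k.+1%:R * h.
    by rewrite -!natr1 natrD; ring.
  by rewrite cosB cosD; field.
rewrite -mulr_suml sumrB sumr_const_nat subn0 -[_ *+ n]mulr_natl.
rewrite mulrA mulrBr sin_mul_sum_cos_progression.
have -> : (j%:R + 2) * h + (2 * n%:R - 1) * h = - (j%:R * h + h) + pi *+ 2.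
  by rewrite En -hN mulr2n; ring.
have -> : (j%:R + 2) * h - h = j%:R * h + h by ring.
by rewrite sinD2pi sinN sinD En; field.
Qed.

Lemma is_derive_sin_scale (R : realType) (c x : R) :
  is_derive x 1 (fun t : R => sin (c * t)) (c * cos (c * x)).
Proof.
have H : is_derive x 1 (fun t : R => c * t) c.
  have := @is_deriveZ R R R id c x 1 1 (is_derive_id _ _).
  by rewrite /GRing.scale /= mulr1.
have := @is_derive1_comp R sin (fun t => c * t) x _ _ (is_derive_sin _) H.
by rewrite mulrC.
Qed.

Lemma nondecreasing_of_is_derive (R : realType) (f df : R -> R) :
  (forall x : R, is_derive x 1 f (df x)) -> (forall x, 0 <= df x) ->
  {homo f : x y / x <= y}.
Proof.
move=> fD df0 x y lexy.
have [|c _ E] := @MVT_segment R f df x y lexy (fun z _ => fD z).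
  apply: derivable_within_continuous => z _; apply: ex_derive; exact: fD.
by rewrite -subr_ge0 E mulr_ge0 ?df0 ?subr_ge0.
Qed.

Lemma is_derive_sine_sum (R : realType) (w : nat -> R) (n : nat) (x : R) :
  is_derive x 1
    (fun t : R => t / 2 + \sum_(1 <= j < n.+1) w j * (sin (j%:R * t) / j%:R))
    (1 / 2 + \sum_(1 <= j < n.+1) w j * cos (j%:R * x)).
Proof.
elim: n => [|n IHn].
  rewrite big_geq // addr0.
  have := @is_deriveZ R R R id 2^-1 x 1 1 (is_derive_id _ _).
  have -> : 2^-1 *: 1 = 1 / 2 :> R by rewrite /GRing.scale /= mulrC.
  suff -> : 2^-1 \*: id = fun t : R =>
      t / 2 + \sum_(1 <= j < 1) w j * (sin (j%:R * t) / j%:R) by [].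
  by apply/funext => t; rewrite big_geq // addr0 /= /GRing.scale /= mulrC.
have := is_deriveD IHn
  (is_deriveZ (w n.+1 / n.+1%:R) (is_derive_sin_scale R n.+1%:R x)).
rewrite [in X in _ -> X](big_nat_recr n.+1) //= addrA.
have -> : (w n.+1 / n.+1%:R) *: (n.+1%:R * cos (n.+1%:R * x))
    = w n.+1 * cos (n.+1%:R * x).
  by rewrite /GRing.scale /= mulrA divfK ?pnatr_eq0.
congr is_derive; apply/funext => t.
rewrite [in RHS](big_nat_recr n.+1) //= addrA; congr (_ + _).
by rewrite /= /GRing.scale /=; ring.
Qed.

(** The Jackson factors are the autocorrelations of [s_k = sin ((k + 1) h)]
divided by the one at lag 0, which is [(d + 2) / 2]; hence [d + 2] times the
kernel is a sum of two squares. *)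
Lemma jackson_kernel_ge0 (R : realType) (d : nat) (t : R) :
  0 <= 1 / 2 + \sum_(1 <= j < d.+1) jackson_factor R d j * cos (j%:R * t).
Proof.
set h : R := pi / (d%:R + 2).
have N0 : 0 < d%:R + 2 :> R by rewrite ltr_wpDl.
have s0 : 0 < sin h.
  rewrite sin_gt0_pi // divr_gt0 ?pi_gt0 //= ltr_pdivrMr // ltr_pMr ?pi_gt0 //.
  by rewrite ltr_wpDl // ltr1n.
pose s k : R := sin (k.+1%:R * h).
pose A j := \sum_(0 <= k < d.+1 - j) s k * s (k + j)%N.
have EA j : (j <= d)%N -> A j = (d%:R + 2) / 2 * jackson_factor R d j.
  move=> lejd; rewrite /jackson_factor -/h -sine_autocorrelation // -/h -/(A j).
  field.
  by rewrite (gt_eqF s0) (gt_eqF N0).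
have A0 : \sum_(0 <= k < d.+1) s k ^+ 2 = (d%:R + 2) / 2.
  transitivity (A 0%N).
    by rewrite /A subn0; apply: eq_bigr => k _; rewrite addn0 expr2.
  rewrite EA // /jackson_factor mul0r cos0 sin0 subr0 mulr0 addr0 mulr1 -/h.
  by rewrite divff ?mulr1 // mulf_neq0 // gt_eqF.
have := sum_cos_sin_sqr R s d.+1 t; rewrite A0.
have -> : \sum_(1 <= j < d.+1)
      (\sum_(0 <= k < d.+1 - j) s k * s (k + j)%N) * cos (j%:R * t)
    = (d%:R + 2) / 2
      * \sum_(1 <= j < d.+1) jackson_factor R d j * cos (j%:R * t).
  rewrite mulr_sumr; apply: eq_big_nat => j /andP[_ ltjd].
  by rewrite -/(A j) (EA j ltjd) [RHS]mulrA.
set K := \sum_(1 <= j < d.+1) _ => E.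
rewrite -(pmulr_rge0 _ N0).
have -> : (d%:R + 2) * (1 / 2 + K)
    = (d%:R + 2) / 2 + 2 * ((d%:R + 2) / 2 * K) by field.
by rewrite -E addr_ge0 ?sqr_ge0.
Qed.

Lemma acos_nonincreasing (R : realType) (a b : R) :
  -1 <= a -> a <= b -> b <= 1 -> acos b <= acos a.
Proof.
move=> ha hab hb.
have ia : -1 <= a <= 1 by rewrite ha (le_trans hab).
have ib : -1 <= b <= 1 by rewrite hb (le_trans ha).
by rewrite leNgt -ltr_cos ?acosK ?in_itv //= ?acos_ge0 ?acos_lepi // -leNgt.
Qed.

Theorem theorem3p1 (R : realType) (a b : R) (d : nat)
  (ha : -1 <= a) (hab : a < b) (hb : b <= 1) (hd : (1 <= d)%N) (theta : R) :
  0 <= chebyshev_jackson a b d theta <= 1.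
Proof.
pose w j := jackson_factor R d j * cos (j%:R * theta).
pose H (t : R) := t / 2 + \sum_(1 <= j < d.+1) w j * (sin (j%:R * t) / j%:R).
have H_homo : {homo H : x y / x <= y}.
  apply: nondecreasing_of_is_derive (is_derive_sine_sum R w d) _ => x.
  (* The derivative of [H] at [x] is the mean of the kernel at [x + theta] and
     at [x - theta]. *)
  have K1 := jackson_kernel_ge0 R d (x + theta).
  have K2 := jackson_kernel_ge0 R d (x - theta).
  have := addr_ge0 K1 K2; rewrite addrACA -big_split /=.
  have -> : \sum_(1 <= j < d.+1)
      (jackson_factor R d j * cos (j%:R * (x + theta))
       + jackson_factor R d j * cos (j%:R * (x - theta)))
      = 2 * \sum_(1 <= j < d.+1) w j * cos (j%:R * x).
    rewrite mulr_sumr; apply: eq_bigr => j _.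
    by rewrite mulrDr mulrBr cosD cosB /w; ring.
  by lra.
have H0 : H 0 = 0.
  rewrite /H mul0r add0r big1 // => j _.
  by rewrite mulr0 sin0 mul0r mulr0.
have sin_natpi j : sin (j%:R * pi) = 0 :> R.
  elim: j => [|j IHj]; first by rewrite mul0r sin0.
  by rewrite -natr1 mulrDl mul1r sinDpi IHj oppr0.
have Hpi : H pi = pi / 2.
  rewrite /H big1 ?addr0 // => j _.
  by rewrite sin_natpi mul0r mulr0.
have -> : chebyshev_jackson a b d theta = 2 / pi * (H (acos a) - H (acos b)).
  rewrite /chebyshev_jackson /H opprD addrACA -sumrB mulrDr; congr (_ + _).
    by rewrite /step_coef -mulrBl mulrA.
  rewrite mulr_sumr; apply: eq_big_nat => -[|j] // _.
  by rewrite /step_coef /w; ring.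
have ia : -1 <= a <= 1 by rewrite ha (le_trans (ltW hab)).
have ib : -1 <= b <= 1 by rewrite hb (le_trans ha) ?ltW.
have H1 : H 0 <= H (acos b) by rewrite H_homo ?acos_ge0.
have H2 : H (acos b) <= H (acos a).
  by rewrite H_homo ?acos_nonincreasing // ltW.
have H3 : H (acos a) <= H pi by rewrite H_homo ?acos_lepi.
rewrite mulr_ge0 ?subr_ge0 ?divr_ge0 ?pi_ge0 //=.
rewrite mulrAC ler_pdivrMr ?pi_gt0 // mul1r.
by lra.
Qed.
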